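(* Let $G$ be a connected simple graph with $n$ vertices and let $F=\{f_i\}_{i\in[n]}$ be a $G(n,n-1)$-frame for $\mathbb{C}^{n-1}$ with frame operator $S$. Then the family of dual frames of $F$ is $\left\{\{S^{-1}f_i+h\}_{i\in[n]} : h\in\mathbb{C}^{n-1}\right\}$.
   Context: $[n]=\{1,\dots,n\}$. A sequence $\{f_i\}_{i\in[n]}$ in $\mathbb{C}^k$ is a frame for $\mathbb{C}^k$ if there are constants $A,B>0$ with $A\|f\|^2\le\sum_{i\in[n]}|\langle f,f_i\rangle|^2\le B\|f\|^2$ for all $f\in\mathbb{C}^k$ (inner product linear in the first argument). Its frame operator is $S(f)=\sum_{i\in[n]}\langle f,f_i\rangle f_i$, which is invertible. Its Gramian matrix is the $n\times n$ matrix whose $(i,j)$ entry is $\langle f_j,f_i\rangle$. A frame $\{g_i\}_{i\in[n]}$ for $\mathbb{C}^k$ is a dual frame of $\{f_i\}_{i\in[n]}$ if $f=\sum_{i\in[n]}\langle f,f_i\rangle g_i=\sum_{i\in[n]}\langle f,g_i\rangle f_i$ for all $f\in\mathbb{C}^k$. The Laplacian matrix of a simple graph $G$ with vertices $v_1,\dots,v_n$ is $L(G)=D(G)-A(G)$, where $D(G)$ is the diagonal matrix of vertex degrees and $A(G)$ is the adjacency matrix. A frame $\{f_i\}_{i\in[n]}$ for $\mathbb{C}^k$ is a $G(n,k)$-frame if its Gramian matrix equals $L(G)$ (for connected $G$, necessarily $k=n-1$). *)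

(* Defs.v *)
From HB Require Import structures.
From mathcomp Require Import all_boot all_order all_algebra complex.
From mathcomp Require Import all_classical reals.

Set Implicit Arguments.
Unset Strict Implicit.
Unset Printing Implicit Defensive.

Import Order.TTheory GRing.Theory Num.Theory.
Local Open Scope ring_scope.
Local Open Scope complex_scope.

(* The inner product on C^k is [dotmx u v] = \sum_j u_j * (v_j)^* of
   spectral.v, linear in its first argument; vectors are row vectors. *)

Section Frames.
Variables (R : realType) (n k : nat).
Implicit Types (f g : 'I_n -> 'rV[R[i]]_k) (x : 'rV[R[i]]_k).

(* [dotmx x x] is the squared norm of x. *)
Definition is_frame f : Prop :=
  exists A B : R, [/\ 0 < A, 0 < B &
    forall x, A%:C * dotmx x x <= \sum_i `|dotmx x (f i)| ^+ 2
                               <= B%:C * dotmx x x].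

Definition frame_op f x : 'rV[R[i]]_k := \sum_i dotmx x (f i) *: f i.

Fact frame_op_is_linear f : linear (frame_op f).
Proof.
move=> a x y; rewrite /frame_op scaler_sumr -big_split /=.
apply: eq_bigr => i _.
by rewrite !dotmxE mulmxDl -scalemxAl !mxE scalerDl scalerA.
Qed.

HB.instance Definition _ f :=
  GRing.isLinear.Build R[i] 'rV[R[i]]_k 'rV[R[i]]_k _ (frame_op f)
    (frame_op_is_linear f).

Definition frame_operator f : 'End('rV[R[i]]_k) := linfun (frame_op f).

(* The frame operator of a frame is injective, so [(frame_operator f)^-1%VF]
   is its two-sided inverse. *)
Lemma lker_frame_operator f : is_frame f -> lker (frame_operator f) == 0%VS.
Proof.
move=> [A [B [A0 _ AB]]]; apply/lker0P => x y.
rewrite /frame_operator !lfunE => /eqP; rewrite -subr_eq0 -raddfB /= => /eqP S0.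
apply/eqP; rewrite -subr_eq0; move: (x - y) S0 => z S0.
have : \sum_i `|dotmx z (f i)| ^+ 2 = dotmx (frame_op f z) z.
  rewrite /frame_op dotmxE mulmx_suml summxE; apply: eq_bigr => i _.
  rewrite -scalemxAl mxE -dotmxE normCK; congr (_ * _).
  rewrite !dotmxE !mxE rmorph_sum; apply: eq_bigr => j _.
  by rewrite !mxE rmorphM /= conjCK mulrC.
rewrite S0 dotmxE mul0mx mxE => s0.
have /andP[+ _] := AB z; rewrite s0; apply: contraTT => z0.
by rewrite lt_geF // mulr_gt0 ?ltcR // dotmx_is_dotmx.
Qed.

Definition gramian f : 'M[R[i]]_n := \matrix_(i, j) dotmx (f j) (f i).

Definition is_dual_frame f g : Prop :=
  [/\ is_frame g,
      forall x, x = \sum_i dotmx x (f i) *: g i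
    & forall x, x = \sum_i dotmx x (g i) *: f i].

End Frames.

Section Laplacian.
Variables (K : pzRingType) (n : nat) (e : rel 'I_n).

Definition degree (v : 'I_n) : nat := #|[set w | e v w]%SET|.

Definition adjacency : 'M[K]_n := \matrix_(i, j) (e i j)%:R.

Definition laplacian : 'M[K]_n :=
  diag_mx (\row_i (degree i)%:R) - adjacency.

End Laplacian.

Arguments laplacian K {n} e.

(* f is a G(n,k)-frame, G being the graph with adjacency relation e. *)
Definition is_graph_frame (R : realType) (n k : nat) (e : rel 'I_n)
    (f : 'I_n -> 'rV[R[i]]_k) : Prop :=
  is_frame f /\ gramian f = laplacian R[i] e.

(* Main.v *)
Require Import Defs.
From mathcomp Require Import all_boot all_order all_algebra complex.
From mathcomp Require Import all_classical reals.

Set Implicit Arguments.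
Unset Strict Implicit.
Unset Printing Implicit Defensive.

Import Order.TTheory GRing.Theory Num.Theory.
Local Open Scope ring_scope.
Local Open Scope complex_scope.
Local Open Scope classical_set_scope.

(** Write [F] for the matrix whose rows are the vectors of a family [f], and
    [F^*] for its conjugate transpose. The analysis map of [f] is right
    multiplication by [F^*], and [g] is dual to [f] exactly when
    [F^* G = 1] ([is_dual_frameP]): taking adjoints gives the second
    reconstruction formula, and the frame bounds of [g] are automatic in finite
    dimension. So duality is an affine condition on [G], satisfied by the
    canonical dual [S^-1 f] ([canonical_dual]), and any other dual differs from
    it by a matrix [D] with [F^* D = 0].

    Since the rows of a Laplacian add up to zero, the squared norm of
    [\sum_i f i], which is the sum of all the entries of the Gramian, vanishes
    ([sum_graph_frame]); hence the constant vector is in the kernel of [F^*].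
    As [F] has [n] rows and rank [n - 1], that kernel is a line, so
    [F^* D = 0] means that each column of [D] is constant, i.e., that all the
    rows of [D] are equal to a single vector [h] ([dual_frame_translates]). *)

Local Notation "M ^t*" := (map_mx Num.conj (trmx M)) (at level 30).

Lemma adjmxM (C : numClosedFieldType) m n p (A : 'M[C]_(m, n))
  (B : 'M[C]_(n, p)) : (A *m B)^t* = B^t* *m A^t*.
Proof. by rewrite trmx_mul map_mxM. Qed.

Definition family_mx (K : Type) n k (f : 'I_n -> 'rV[K]_k) : 'M[K]_(n, k) :=
  \matrix_(i, j) f i 0 j.

Section Families.
Variables (R : realType) (n k : nat).
Implicit Types (f g : 'I_n -> 'rV[R[i]]_k) (x : 'rV[R[i]]_k).

Lemma analysisE f x i : (x *m (family_mx f)^t*) 0 i = dotmx x (f i).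
Proof.
by rewrite dotmxE !mxE; apply: eq_bigr => j _; rewrite !mxE.
Qed.

Lemma synthesisE f (c : 'rV[R[i]]_n) :
  c *m family_mx f = \sum_i c 0 i *: f i.
Proof.
apply/rowP => j; rewrite summxE mxE; apply: eq_bigr => i _.
by rewrite !mxE.
Qed.

Lemma sum_analysisE f x :
  \sum_i `|dotmx x (f i)| ^+ 2 =
  dotmx (x *m (family_mx f)^t*) (x *m (family_mx f)^t*).
Proof.
rewrite [RHS]dotmxE mxE; apply: eq_bigr => i _.
by rewrite normCK -analysisE [(_^t*) i 0]mxE [_^T i 0]mxE.
Qed.

Lemma reconstructionP f g :
  (forall x, x = \sum_i dotmx x (f i) *: g i) <->
  (family_mx f)^t* *m family_mx g = 1%:M.
Proof.
have E x : \sum_i dotmx x (f i) *: g i =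
    x *m ((family_mx f)^t* *m family_mx g).
  by rewrite mulmxA synthesisE; apply: eq_bigr => i _; rewrite analysisE.
split=> [fg|fg x]; last by rewrite E fg mulmx1.
by apply/row_matrixP => i; rewrite !rowE mulmx1 -E -fg.
Qed.

Lemma reconstructionC f g :
  (family_mx f)^t* *m family_mx g = 1%:M ->
  (family_mx g)^t* *m family_mx f = 1%:M.
Proof.
move/(congr1 (fun M => M^t*)).
by rewrite adjmxM trmxCK trmx1 map_mx1.
Qed.

(** By Cauchy-Schwarz; the summand 1 keeps the bound positive when all the
    vectors vanish. *)
Lemma bessel_bound f : exists2 B : R, 0 < B &
  forall x, \sum_i `|dotmx x (f i)| ^+ 2 <= B%:C * dotmx x x.
Proof.
pose b : R[i] := 1 + \sum_i dotmx (f i) (f i).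
have s_ge0 : 0 <= \sum_i dotmx (f i) (f i).
  by apply: sumr_ge0 => i _; exact: dnorm_ge0.
have b_gt0 : 0 < b by rewrite ltr_pwDl.
have bE : b = (complex.Re b)%:C by rewrite RRe_real // gtr0_real.
exists (complex.Re b); first by rewrite -ltcR -bE.
move=> x; rewrite -bE mulrDl mul1r mulr_suml.
rewrite -[leLHS]add0r lerD ?dnorm_ge0 // ler_sum // => i _.
by rewrite mulrC CauchySchwarz.
Qed.

(** The lower frame bound comes from the Bessel bound [B] of [f]: by
    reconstruction the squared norm of [x] is the inner product of its two
    analysis vectors, so Cauchy-Schwarz gives
    [|x|^4 <= (\sum_i |<x, g i>|^2) * (B * |x|^2)]. *)
Lemma is_frame_reconstruction f g :
  (family_mx f)^t* *m family_mx g = 1%:M -> is_frame g.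
Proof.
move=> fg; have [B B_gt0 fB] := bessel_bound f.
have [B' B'_gt0 gB'] := bessel_bound g.
exists B^-1, B'; split; rewrite ?invr_gt0 // => x; rewrite gB' andbT.
have [->|x_neq0] := eqVneq x 0.
  by rewrite dotmxE mul0mx mxE mulr0 sumr_ge0 // => i _; rewrite exprn_ge0.
have xx_gt0 := dotmx_is_dotmx x_neq0.
have BC_gt0 : 0 < B%:C by rewrite ltcR.
have xxE : dotmx x x =
    dotmx (x *m (family_mx f)^t*) (x *m (family_mx g)^t*).
  by rewrite !dotmxE adjmxM trmxCK mulmxA -(mulmxA x) fg mulmx1.
have le_xx : `|dotmx x x| ^+ 2 <=
    (\sum_i `|dotmx x (f i)| ^+ 2) * (\sum_i `|dotmx x (g i)| ^+ 2).
  by rewrite !sum_analysisE xxE CauchySchwarz.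
rewrite (ger0_norm (ltW xx_gt0)) in le_xx.
have : dotmx x x ^+ 2 <= (B%:C * dotmx x x) * \sum_i `|dotmx x (g i)| ^+ 2.
  apply: le_trans le_xx _; apply: ler_wpM2r (fB x).
  by apply: sumr_ge0 => i _; rewrite exprn_ge0.
rewrite expr2 [B%:C * _]mulrC -mulrA ler_pM2l // => le_x.
by rewrite fmorphV ler_pdivrMl.
Qed.

Lemma is_dual_frameP f g :
  is_dual_frame f g <-> (family_mx f)^t* *m family_mx g = 1%:M.
Proof.
split=> [[_ /reconstructionP]//|fg]; split.
- exact: is_frame_reconstruction fg.
- exact/reconstructionP.
- exact/reconstructionP/reconstructionC.
Qed.

Lemma canonical_dual f : is_frame f ->
  is_dual_frame f (fun i => (frame_operator f)^-1%VF (f i)).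
Proof.
move=> f_frame; apply/is_dual_frameP/reconstructionP => x.
rewrite -[LHS](lker0_lfunK (lker_frame_operator f_frame)).
rewrite [frame_operator f x]lfunE /= linear_sum.
by apply: eq_bigr => i _; rewrite linearZ.
Qed.

(** The norm of the sum is computed row by row: the inner product of
    [\sum_j f j] with [f i] is the sum of row [i] of the Laplacian, where the
    degree cancels against the adjacencies. *)
Lemma sum_graph_frame (e : rel 'I_n) f : is_graph_frame e f -> \sum_i f i = 0.
Proof.
case=> _ fL; apply/eqP; apply: contraTT isT => s_neq0.
have := dotmx_is_dotmx s_neq0; suff -> : dotmx (\sum_i f i) (\sum_i f i) = 0.
  by rewrite ltxx.
rewrite linear_sumr /=; apply: big1 => i _; rewrite linear_sumlz /=.
transitivity (\sum_j gramian f i j); first by apply: eq_bigr => j _; rewrite mxE.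
rewrite fL; under eq_bigr do rewrite !mxE.
rewrite sumrB (bigD1 i) //= eqxx mulr1n big1 ?addr0.
  by rewrite -natr_sum /degree cardsE -sum1_card -big_mkcond subrr.
by move=> j /negPf j_neq_i; rewrite eq_sym j_neq_i.
Qed.

End Families.

(** The matrix [F] has [k + 1] rows, and rank [k] because its adjoint has a right
    inverse; so its left kernel is the line of constant vectors, and the columns
    of the difference of two duals have their conjugates on that line. *)
Lemma dual_frame_translates (R : realType) k (f g g' : 'I_k.+1 -> 'rV[R[i]]_k) :
  \sum_i f i = 0 -> is_dual_frame f g ->
  is_dual_frame f g' <-> exists h, g' = fun i => g i + h.
Proof.
move=> f0 /is_dual_frameP fg.
pose F := family_mx f; pose u : 'rV[R[i]]_k.+1 := const_mx 1.
have uF : u *m F = 0.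
  by rewrite synthesisE -[RHS]f0; apply: eq_bigr => i _; rewrite mxE scale1r.
split=> [/is_dual_frameP fg'|[h ->]].
  pose D := family_mx g' - family_mx g.
  have DF : D^t* *m F = 0.
    by rewrite -[F]trmxCK -adjmxM mulmxBr fg fg' subrr trmx0 map_mx0.
  have rkF : \rank F = k.
    apply/eqP; rewrite eqn_leq rank_leq_col -{1}(mxrank1 R[i] k).
    by rewrite -(reconstructionC fg) mxrankM_maxr.
  have Du : (D^t* <= u)%MS.
    (* A subspace of the same dimension: [u] spans the kernel. *)
    have uK : (u <= kermx F)%MS by apply/sub_kermxP.
    apply: submx_trans (_ : kermx F <= u)%MS; first exact/sub_kermxP.
    rewrite -(mxrank_leqif_sup uK) mxrank_ker rkF subSnn rank_rV.
    suff -> : u != 0 by [].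
    by apply/eqP => /rowP/(_ 0)/eqP; rewrite !mxE oner_eq0.
  exists (row 0 D); apply/funext => i; apply/rowP => j.
  have Dconst : D i j = D 0 j.
    have /submxP[w /matrixP DE] := Du.
    apply: (can_inj (@Num.Theory.conjCK _)).
    have := DE j i; rewrite !mxE => ->.
    by have := DE j 0; rewrite !mxE => ->; apply: eq_bigr => l _; rewrite !mxE.
  by rewrite mxE [row 0 D 0 j]mxE -Dconst !mxE addrC subrK.
apply/is_dual_frameP.
have -> : family_mx (fun i => g i + h) = family_mx g + u^T *m h.
  by apply/matrixP => i j; rewrite !mxE big_ord1 !mxE mul1r.
rewrite mulmxDr fg mulmxA.
suff -> : F^t* *m u^T = 0 by rewrite mul0mx addr0.
have -> : u^T = u^t* by apply/matrixP => i j; rewrite !mxE rmorph1.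
by rewrite -adjmxM uF trmx0 map_mx0.
Qed.

Theorem theorem3p11 (R : realType) (n : nat) (n_gt0 : (0 < n)%N)
    (e : rel 'I_n) (e_sym : symmetric e) (e_irr : irreflexive e)
    (e_conn : forall u v : 'I_n, connect e u v)
    (f : 'I_n -> 'rV[R[i]]_(n.-1)) (f_frame : is_graph_frame e f) :
  [set g : 'I_n -> 'rV[R[i]]_(n.-1) | is_dual_frame f g] =
  [set (fun i : 'I_n => (frame_operator f)^-1%VF (f i) + h)
     | h in [set: 'rV[R[i]]_(n.-1)]].
Proof.
case: n n_gt0 e e_sym e_irr e_conn f f_frame => // k _ e _ _ _ f f_frame.
have dualP g := dual_frame_translates g (sum_graph_frame f_frame)
  (canonical_dual (proj1 f_frame)).
apply/seteqP; split=> g /=.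
  by move=> /dualP[h ->]; exists h.
by case=> h _ <-; apply/dualP; exists h.
Qed.
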